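(* For all integers $c\geq 0$ and $n\geq 0$, \[ d_{125c}(125n+74)\equiv d_{125c}(125n+99)\equiv d_{125c}(125n+124)\equiv 0\pmod{125}. \]
   Context: For a positive integer $m$ and $|q|<1$, let $f_m:=\prod_{n\geq 1}(1-q^{mn})$. For each integer $k\geq 0$, the numbers $d_k(n)$ ($n\geq 0$) are defined by the generating function $\sum_{n\geq 0} d_k(n)q^n = \dfrac{f_2^k}{f_1^{3k+1}}$. *)

(* Defs.v *)
From HB Require Import structures.
From mathcomp Require Import all_boot all_order all_algebra.

Set Implicit Arguments.
Unset Strict Implicit.
Unset Printing Implicit Defensive.

Import Order.TTheory GRing.Theory Num.Theory.
Local Open Scope ring_scope.

(* Formal power series in q over the integers; [a n] is the coefficient
   of q^n in [a]. *)
Definition fps := nat -> int.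

Definition fps_one : fps := fun n => (n == 0%N)%:R.

Definition fps_mul (a b : fps) : fps :=
  fun n => \sum_(i < n.+1) a i * b (n - i)%N.

Definition fps_exp (a : fps) (k : nat) : fps := iter k (fps_mul a) fps_one.

(* Meaningful when a 0 = 1: then [fps_div b a] is the unique series c with
   c * a = b; its coefficients are obtained by solving
   \sum_(i <= n) c_i a_(n-i) = b_n for c_n (see [fps_divK], [fps_div_uniq]).
   [fps_div_seq b a n] lists its first n coefficients. *)
Fixpoint fps_div_seq (b a : fps) (n : nat) : seq int :=
  if n is n'.+1 then
    let s := fps_div_seq b a n' in
    rcons s (b n' - \sum_(i < n') s`_i * a (n' - i)%N)
  else [::].

Definition fps_div (b a : fps) : fps := fun n => (fps_div_seq b a n.+1)`_n.

(* f_m = \prod_(j >= 1) (1 - q^(m j)).  For m >= 1 the factors with j > n do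
   not affect the coefficient of q^n, so it is read off the n-th partial
   product (see [fps_f_stable]). *)
Definition f_partial (m N : nat) : {poly int} :=
  \prod_(1 <= j < N.+1) (1 - 'X^(m * j)).

Definition fps_f (m : nat) : fps := fun n => (f_partial m n)`_n.

Definition d (k : nat) : fps :=
  fps_div (fps_exp (fps_f 2) k) (fps_exp (fps_f 1) (3 * k + 1)).

Lemma fps_f_stable (m n N : nat) :
  (0 < m)%N -> (n <= N)%N -> (f_partial m N)`_n = fps_f m n.
Proof.
move=> m_gt0; elim: N => [|N IHN]; first by rewrite leqn0 => /eqP ->.
rewrite leq_eqVlt => /predU1P[-> //|]; rewrite ltnS => lenN.
rewrite -IHN // /f_partial big_nat_recr //= mulrBr mulr1 coefB coefMXn.
by rewrite (leq_ltn_trans lenN) ?subr0 // -{1}[N.+1]mul1n leq_mul2r m_gt0 orbT.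
Qed.

Lemma size_fps_div_seq (b a : fps) (n : nat) : size (fps_div_seq b a n) = n.
Proof. by elim: n => //= n IHn; rewrite size_rcons IHn. Qed.

Lemma nth_fps_div_seq (b a : fps) (n i : nat) :
  (i < n)%N -> (fps_div_seq b a n)`_i = fps_div b a i.
Proof.
elim: n => // n IHn; rewrite ltnS leq_eqVlt => /predU1P[-> //|ltin].
by rewrite /= nth_rcons size_fps_div_seq ltin IHn.
Qed.

Lemma fps_divE (b a : fps) (n : nat) :
  fps_div b a n = b n - \sum_(i < n) fps_div b a i * a (n - i)%N.
Proof.
rewrite {1}/fps_div /= nth_rcons size_fps_div_seq ltnn eqxx.
by congr (_ - _); apply: eq_bigr => i _; rewrite nth_fps_div_seq.
Qed.

Lemma fps_divK (b a : fps) :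
  a 0%N = 1 -> fps_mul (fps_div b a) a =1 b.
Proof.
move=> a0 n; rewrite /fps_mul big_ord_recr /= subnn a0 mulr1.
by rewrite fps_divE addrC subrK.
Qed.

Lemma fps_div_uniq (b a c : fps) :
  a 0%N = 1 -> fps_mul c a =1 b -> c =1 fps_div b a.
Proof.
move=> a0 ca; elim/ltn_ind => n IHn.
rewrite fps_divE -ca /fps_mul big_ord_recr /= subnn a0 mulr1.
rewrite [X in _ = _ - X](eq_bigr (fun i : 'I_n => c i * a (n - i)%N)).
  by rewrite addrC addrK.
by move=> i _; rewrite IHn.
Qed.

Lemma fps_exp_f0 (m k : nat) : fps_exp (fps_f m) k 0%N = 1.
Proof.
elim: k => // k IHk; rewrite /fps_exp iterS -/(fps_exp _ k) /fps_mul.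
by rewrite big_ord1 IHk mulr1 /fps_f /f_partial big_geq // coef1.
Qed.

Lemma d_gen (k : nat) :
  fps_mul (d k) (fps_exp (fps_f 1) (3 * k + 1)) =1 fps_exp (fps_f 2) k.
Proof. exact/fps_divK/fps_exp_f0. Qed.

(* Main.v *)
Require Import Defs.
From HB Require Import structures.
From mathcomp Require Import all_boot all_order all_algebra all_field.
From mathcomp Require Import boolp.
From mathcomp Require Import zify ring.

(* Write F = f_1, q^5-dissect F = E_0 + E_1 + E_2 by Euler's pentagonal number
   theorem, where E_1 = - q f_25.  Ramanujan's relation E_0 E_2 = - E_1^2 comes
   from a reflection of the lattice of pairs (k, l) that preserves the sum of
   the pentagonal numbers of k and l and reverses the sign (-1)^(k + l).  The
   norm of F over the fifth roots of unity is f_5^6 / f_25; with the relation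
   this yields Ramanujan's identity: the coefficients of 1 / f_1 at 5 n + 4 have
   generating function 5 f_5^5 / f_1^6.

   Put phi = f_2 / f_1^3, so that d_k has generating function phi^k / f_1.
   Since f^(5^(j+1)) = f(q^5)^(5^j) mod 5^(j+1), for k = 125 c the coefficients
   at 5 n + 4 are, mod 125, those of 5 C1 with C1 = f_5^5 f_1^-6 phi^(25 c), and
   C1 = f_1^19 phi(q^5)^(5 c) mod 25.  Expanding f_1^19 in E_0, E_1, E_2, the
   coefficients of C1 at 5 n + 4 are those of 5 C2 mod 25, where C2 is, mod 5,
   f_1^3 times a series in q^5.  Finally the coefficients of f_1^3 at 5 n + 2,
   5 n + 3, 5 n + 4 vanish mod 5. *)

Set Implicit Arguments.
Unset Strict Implicit.
Unset Printing Implicit Defensive.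

Import Order.TTheory GRing.Theory Num.Theory.
Local Open Scope ring_scope.

(** * Formal power series *)

Definition pser (R : Type) := nat -> R.

Section PowerSeriesRing.
Variable R : comNzRingType.
Implicit Types f g h : pser R.

HB.instance Definition _ := gen_eqMixin (pser R).
HB.instance Definition _ := gen_choiceMixin (pser R).

Definition pser_add f g : pser R := fun n => f n + g n.
Definition pser_opp f : pser R := fun n => - f n.
Definition pser_one : pser R := fun n => (n == 0%N)%:R.
Definition pser_mul f g : pser R := fun n => \sum_(i < n.+1) f i * g (n - i)%N.

Fact pser_addA : associative pser_add.
Proof. by move=> f g h; apply/funext => n; apply: addrA. Qed.
Fact pser_addC : commutative pser_add.
Proof. by move=> f g; apply/funext => n; apply: addrC. Qed.
Fact pser_add0 : left_id (fun=> 0 : R) pser_add.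
Proof. by move=> f; apply/funext => n; apply: add0r. Qed.
Fact pser_addN : left_inverse (fun=> 0 : R) pser_opp pser_add.
Proof. by move=> f; apply/funext => n; apply: addNr. Qed.

HB.instance Definition _ :=
  GRing.isZmodule.Build (pser R) pser_addA pser_addC pser_add0 pser_addN.

Definition trunc N f : {poly R} := \poly_(i < N) f i.

Lemma coef_trunc N f n : (n < N)%N -> (trunc N f)`_n = f n.
Proof. by rewrite coef_poly => ->. Qed.

(** Coefficients below [N] of a product depend only on the truncations, so commutativity and
    associativity are inherited from [{poly R}]. *)
Lemma pser_mulE N f g n :
  (n < N)%N -> pser_mul f g n = (trunc N f * trunc N g)`_n.
Proof.
move=> nN; rewrite coefM; apply: eq_bigr => i _.
have iN : (i < N)%N by rewrite (leq_ltn_trans _ nN) // -ltnS.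
by rewrite !coef_trunc // (leq_ltn_trans (leq_subr _ _) nN).
Qed.

Fact pser_mulC : commutative pser_mul.
Proof. by move=> f g; apply/funext => n; rewrite !(@pser_mulE n.+1) // mulrC. Qed.

Fact pser_mulA : associative pser_mul.
Proof.
move=> f g h; apply/funext => n.
transitivity ((trunc n.+1 f * (trunc n.+1 g * trunc n.+1 h))`_n).
  rewrite coefM; apply: eq_bigr => i _.
  by rewrite coef_trunc // (@pser_mulE n.+1) // ltnS leq_subr.
rewrite mulrA coefM; apply: eq_bigr => i _.
by rewrite (@pser_mulE n.+1) // [X in _ * X]coef_trunc // ltnS leq_subr.
Qed.

Fact pser_mul1 : left_id pser_one pser_mul.
Proof.
move=> f; apply/funext => n; rewrite /pser_mul big_ord_recl /= mul1r subn0.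
by rewrite big1 ?addr0 // => i _; rewrite mul0r.
Qed.

Fact pser_mulDl : left_distributive pser_mul pser_add.
Proof.
move=> f g h; apply/funext => n.
by rewrite /pser_mul /pser_add -big_split; apply: eq_bigr => i _; rewrite mulrDl.
Qed.

Fact pser_1neq0 : pser_one != 0.
Proof.
by apply/eqP => /(congr1 (@^~ 0%N)) /eqP; rewrite /pser_one oner_eq0.
Qed.

HB.instance Definition _ := GRing.Zmodule_isComNzRing.Build (pser R)
  pser_mulA pser_mulC pser_mul1 pser_mulDl pser_1neq0.

Lemma coefpD f g n : (f + g) n = f n + g n. Proof. by []. Qed.
Lemma coefpN f n : (- f) n = - f n. Proof. by []. Qed.
Lemma coefpM f g n : (f * g) n = \sum_(i < n.+1) f i * g (n - i)%N.
Proof. by []. Qed.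
Lemma coefp1 n : (1 : pser R) n = (n == 0%N)%:R. Proof. by []. Qed.
Lemma coefp0 n : (0 : pser R) n = 0. Proof. by []. Qed.

Lemma coefp_sum I (s : seq I) (P : pred I) (F : I -> pser R) n :
  (\sum_(i <- s | P i) F i) n = \sum_(i <- s | P i) F i n.
Proof. exact: (big_morph (fun f : pser R => f n)). Qed.

Lemma coefpMn f k n : (f *+ k) n = f n *+ k.
Proof. by elim: k => // k IH; rewrite !mulrS coefpD IH. Qed.

Definition mono k : pser R := fun n => (n == k)%:R.
Arguments mono k%_N.

Lemma coefp_monoM k f n :
  (mono k * f) n = if (n < k)%N then 0 else f (n - k)%N.
Proof.
rewrite coefpM; case: ltnP => [nk|kn].
  rewrite big1 // => i _; rewrite /mono ltn_eqF ?mul0r //.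
  by rewrite (leq_trans (ltn_ord i)).
have kn' : (k < n.+1)%N by [].
rewrite (bigD1 (Ordinal kn')) //= big1 ?addr0 ?/mono ?eqxx ?mul1r //.
by move=> i; rewrite -val_eqE /mono /= => /negbTE ->; rewrite mul0r.
Qed.

Lemma mono0 : mono 0 = 1. Proof. by []. Qed.

Lemma monoM k l : mono k * mono l = mono (k + l).
Proof.
apply/funext => n; rewrite coefp_monoM /mono; case: ltnP => kn.
  by rewrite ltn_eqF //; lia.
by congr (_%:R); lia.
Qed.

Lemma mono1X k : mono 1 ^+ k = mono k.
Proof. by elim: k => // k IH; rewrite exprS IH monoM. Qed.

Lemma monoX k l : mono k ^+ l = mono (k * l).
Proof. by rewrite -(mono1X k) -exprM mono1X. Qed.

End PowerSeriesRing.
Arguments mono {R} k%_N.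
Notation q := (mono 1).

(** * Dissection modulo 5 *)

Section Dissection.
Variable R : comNzRingType.
Implicit Types f g h : pser R.

(* [V f] is f(q^5); [U r f] collects the coefficients of f at 5 n + r. *)
Definition V f : pser R := fun n => if (5 %| n)%N then f (n %/ 5)%N else 0.

Definition U r f : pser R := fun n => f (5 * n + r)%N.

(** The bound [(N + 4) %/ 5] counts the multiples of 5 below [N]. *)
Lemma sum_multiples5 (H : nat -> R) N :
  \sum_(0 <= i < N) (if (5 %| i)%N then H (i %/ 5)%N else 0)
    = \sum_(0 <= j < (N + 4) %/ 5) H j.
Proof.
elim: N => [|N IH]; first by rewrite !big_geq.
rewrite big_nat_recr //= {}IH; case: ifP => N5.
  by rewrite (_ : (N.+1 + 4) %/ 5 = ((N + 4) %/ 5).+1)%N 1?big_nat_recr //=;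
    [congr (_ + H _)|]; lia.
by rewrite addr0; congr (\sum_(0 <= j < _) _); lia.
Qed.

(** Only indices divisible by 5 contribute to the convolution; as r < 5, those up to 5 n + r are the
    5 j with j <= n. *)
Lemma U_VM r f g : (r < 5)%N -> U r (V g * f) = g * U r f.
Proof.
move=> r5; apply/funext => n; rewrite /U !coefpM.
pose H j := g j * f (5 * n + r - 5 * j)%N.
transitivity (\sum_(0 <= j < n.+1) H j); last first.
  rewrite big_mkord; apply: eq_bigr => j _; congr (_ * f _).
  by have := ltn_ord j; lia.
rewrite (_ : n.+1 = (((5 * n + r).+1 + 4) %/ 5)%N); last by lia.
rewrite -sum_multiples5 big_mkord; apply: eq_bigr => i _.
rewrite /V /H; case: ifP => [i5|_]; last by rewrite mul0r.
by congr (_ * f _); lia.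
Qed.

Lemma U_ext f g : (forall r, (r < 5)%N -> U r f = U r g) -> f = g.
Proof.
move=> fg; apply/funext => n.
have /(congr1 (@^~ (n %/ 5)%N)) := fg (n %% 5)%N (@ltn_pmod n 5 isT).
by rewrite /U mulnC -divn_eq.
Qed.

Lemma U_V r g : (r < 5)%N -> U r (V g) = if r == 0%N then g else 0.
Proof.
move=> r5; apply/funext => n; rewrite /U /V.
case: eqP => [->|r0].
  by rewrite addn0 dvdn_mulr // mulKn.
by rewrite (_ : (5 %| _)%N = false) //; lia.
Qed.

Fact V_zmod_morphism : zmod_morphism V.
Proof.
move=> f g; apply/funext => n; rewrite coefpD coefpN /V.
by case: ifP => // _; rewrite subrr.
Qed.

Fact V_monoid_morphism : monoid_morphism V.
Proof.
split=> [|f g]; apply: U_ext => r r5.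
  rewrite U_V //; apply/funext => n; rewrite /U coefp1.
  by case: r r5 => [|r] r5 /=; rewrite ?coefp1 ?coefp0; case: n.
rewrite U_VM // !U_V //; case: ifP => // _; by rewrite mulr0.
Qed.

HB.instance Definition _ := GRing.isZmodMorphism.Build _ _ V V_zmod_morphism.
HB.instance Definition _ :=
  GRing.isMonoidMorphism.Build _ _ V V_monoid_morphism.

Fact U_zmod_morphism r : zmod_morphism (U r). Proof. by []. Qed.
HB.instance Definition _ r :=
  GRing.isZmodMorphism.Build _ _ (U r) (U_zmod_morphism r).

Lemma V_mono k : V (mono k) = mono (5 * k) :> pser R.
Proof.
apply/funext => n; rewrite /V /mono; case: ifP => n5.
  by congr (_%:R); lia.
by rewrite (_ : (n == _) = false) //; lia.
Qed.

Lemma U_mono r s : (r < 5)%N -> (s < 5)%N -> 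
  U r (mono s) = if r == s then 1 else 0 :> pser R.
Proof.
move=> r5 s5; apply/funext => n; rewrite /U /mono.
case: (eqVneq r s) => [->|rs].
  by rewrite coefp1; congr (_%:R); lia.
by rewrite coefp0 (_ : (_ == _) = false) //; lia.
Qed.

Lemma U_monoV r s g : (r < 5)%N -> (s < 5)%N ->
  U r (mono s * V g) = if r == s then g else 0.
Proof.
by move=> r5 s5; rewrite mulrC U_VM // U_mono //; case: eqP;
  rewrite ?mulr1 ?mulr0.
Qed.

Lemma dissection f : f = \sum_(r < 5) mono r * V (U r f).
Proof.
apply: U_ext => s s5; rewrite raddf_sum (bigD1 (Ordinal s5)) //=.
rewrite U_monoV // eqxx big1 ?addr0 // => r.
by rewrite -val_eqE U_monoV // eq_sym => /negbTE /= ->.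
Qed.

Lemma U_dissected g0 g1 g2 g3 g4 r :
  (r < 5)%N ->
  U r (V g0 + q * V g1 + q ^+ 2 * V g2 + q ^+ 3 * V g3 + q ^+ 4 * V g4)
    = nth 0 [:: g0; g1; g2; g3; g4] r.
Proof.
move=> r5; rewrite !raddfD /= -[V g0]mul1r -(mono0 R) !mono1X !U_monoV //.
by move: r r5 => [|[|[|[|[|r]]]]] //= _; rewrite ?addr0 ?add0r.
Qed.

(* f(z q) *)
Definition twist (z : R) f : pser R := fun n => z ^+ n * f n.

Fact twist_zmod_morphism z : zmod_morphism (twist z).
Proof. by move=> f g; apply/funext => n; apply: mulrBr. Qed.

Fact twist_monoid_morphism z : monoid_morphism (twist z).
Proof.
split=> [|f g]; apply/funext => n.
  by rewrite /twist !coefp1; case: n => [|n]; rewrite ?mulr1 ?mulr0.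
rewrite /twist !coefpM mulr_sumr; apply: eq_bigr => i _.
by rewrite mulrACA -exprD subnKC // -ltnS.
Qed.

HB.instance Definition _ z :=
  GRing.isZmodMorphism.Build _ _ (twist z) (twist_zmod_morphism z).
HB.instance Definition _ z :=
  GRing.isMonoidMorphism.Build _ _ (twist z) (twist_monoid_morphism z).

Definition const (c : R) : pser R := fun n => if n == 0%N then c else 0.

Lemma coefp_constM c f n : (const c * f) n = c * f n.
Proof.
rewrite coefpM big_ord_recl subn0 big1 ?addr0 // => i _.
by rewrite /const /= mul0r.
Qed.

Fact const_zmod_morphism : zmod_morphism const.
Proof.
by move=> c d; apply/funext => n; rewrite coefpD coefpN /const; case: eqP;
  rewrite ?subrr.
Qed.

Fact const_monoid_morphism : monoid_morphism const.
Proof.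
split=> [|c d]; apply/funext => n; rewrite /const ?coefp1.
  by case: eqP.
by rewrite coefp_constM; case: eqP; rewrite ?mulr0.
Qed.

HB.instance Definition _ :=
  GRing.isZmodMorphism.Build _ _ const const_zmod_morphism.
HB.instance Definition _ :=
  GRing.isMonoidMorphism.Build _ _ const const_monoid_morphism.

Lemma twist_mono z k : twist z (mono k) = const (z ^+ k) * mono k.
Proof.
apply/funext => n; rewrite coefp_constM /twist /mono.
by case: eqP => [->|]; rewrite ?mulr0.
Qed.

Lemma twist_V z f : z ^+ 5 = 1 -> twist z (V f) = V f.
Proof.
move=> z5; apply/funext => n; rewrite /twist /V; case: ifP => n5; last by rewrite mulr0.
by rewrite -[in z ^+ n](divnK n5) mulnC exprM z5 expr1n mul1r.
Qed.

Definition polyser (p : {poly R}) : pser R := fun n => p`_n.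

Fact polyser_zmod_morphism : zmod_morphism polyser.
Proof. by move=> p r; apply/funext => n; apply: coefB. Qed.
Fact polyser_monoid_morphism : monoid_morphism polyser.
Proof.
by split=> [|p r]; apply/funext => n; rewrite /polyser ?coef1 ?coefM.
Qed.
HB.instance Definition _ :=
  GRing.isZmodMorphism.Build _ _ polyser polyser_zmod_morphism.
HB.instance Definition _ :=
  GRing.isMonoidMorphism.Build _ _ polyser polyser_monoid_morphism.

Lemma polyserXn k : polyser 'X^k = mono k.
Proof. by apply/funext => n; rewrite /polyser coefXn. Qed.

(** Congruence modulo q^N. Identities between infinite products are proved for partial products and
    transferred by [agree_eq]. *)
Definition agree N f g := forall n, (n < N)%N -> f n = g n.
Arguments agree N%_N f g.

Lemma agreeW N M f g : (N <= M)%N -> agree M f g -> agree N f g.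
Proof. by move=> NM fg n nN; apply: fg; apply: leq_trans NM. Qed.

Lemma agree_trans N f g h : agree N f g -> agree N g h -> agree N f h.
Proof. by move=> fg gh n nN; rewrite fg ?gh. Qed.

Lemma agree_sym N f g : agree N f g -> agree N g f.
Proof. by move=> fg n nN; rewrite fg. Qed.

Lemma agreeD N f f' g g' :
  agree N f f' -> agree N g g' -> agree N (f + g) (f' + g').
Proof. by move=> ff gg n nN; rewrite !coefpD ff ?gg. Qed.

Lemma agreeM N f f' g g' :
  agree N f f' -> agree N g g' -> agree N (f * g) (f' * g').
Proof.
move=> ff gg n nN; rewrite !coefpM; apply: eq_bigr => i _.
by rewrite ff ?gg //; have := ltn_ord i; lia.
Qed.

Lemma agreeX N f g k : agree N f g -> agree N (f ^+ k) (g ^+ k).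
Proof. by move=> fg; elim: k => // k IH; rewrite !exprS; apply: agreeM. Qed.

Lemma agree_V N f g : agree N f g -> agree N (V f) (V g).
Proof. by move=> fg n nN; rewrite /V; case: ifP => // n5; apply: fg; lia. Qed.

Lemma agree_twist N z f g : agree N f g -> agree N (twist z f) (twist z g).
Proof. by move=> fg n nN; rewrite /twist fg. Qed.

Lemma agree_eq f g : (forall N, agree N f g) -> f = g.
Proof. by move=> fg; apply/funext => n; apply: (fg n.+1). Qed.

Definition eprod n : pser R := \prod_(i < n) (1 - mono i.+1).

End Dissection.
Arguments eprod R n%_N.

Section MapSeries.
Variables (R S : comNzRingType) (phi : {rmorphism R -> S}).

(** Serves to carry integer series into [algC], where fifth roots of unity exist. *)
Definition mapser (f : pser R) : pser S := fun n => phi (f n).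

Fact mapser_zmod_morphism : zmod_morphism mapser.
Proof. by move=> f g; apply/funext => n; apply: rmorphB. Qed.
Fact mapser_monoid_morphism : monoid_morphism mapser.
Proof.
split=> [|f g]; apply/funext => n; first by rewrite /mapser coefp1 rmorph_nat.
rewrite /mapser !coefpM rmorph_sum; apply: eq_bigr => i _; exact: rmorphM.
Qed.
HB.instance Definition _ :=
  GRing.isZmodMorphism.Build _ _ mapser mapser_zmod_morphism.
HB.instance Definition _ :=
  GRing.isMonoidMorphism.Build _ _ mapser mapser_monoid_morphism.

Lemma mapser_mono k : mapser (mono k) = mono k.
Proof. by apply/funext => n; rewrite /mapser /mono rmorph_nat. Qed.

Lemma mapser_V f : mapser (V f) = V (mapser f).
Proof. by apply/funext => n; rewrite /mapser /V; case: ifP; rewrite ?rmorph0. Qed.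

Lemma mapser_eprod n : mapser (eprod R n) = eprod S n.
Proof.
rewrite /eprod rmorph_prod; apply: eq_bigr => i _.
by rewrite rmorphB rmorph1 /= mapser_mono.
Qed.

Lemma agree_mapser N f g : agree N f g -> agree N (mapser f) (mapser g).
Proof. by move=> fg n nN; rewrite /mapser fg. Qed.

End MapSeries.

Definition euler : pser int := fps_f 1.

Lemma agree_euler N : agree N.+1 euler (eprod int N).
Proof.
move=> n nN; rewrite /euler -(@fps_f_stable 1 n N) //.
transitivity (polyser (f_partial 1 N) n) => //.
rewrite /f_partial rmorph_prod big_add1 big_mkord /eprod.
congr (_ n); apply: eq_bigr => i _.
by rewrite rmorphB rmorph1 /= polyserXn mul1n.
Qed.

(** * The norm over the fifth roots of unity *)

Section FifthRoot.
Variables (R : comNzRingType) (w : R).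
Hypothesis w_cyc : 1 + w + w ^+ 2 + w ^+ 3 + w ^+ 4 = 0.

(** Together with [cyc5E], a rewrite rule by which [ring] brings polynomials in [w] down to degree
    at most 3. *)
Lemma cyc4E : w ^+ 4 = - 1 - w - w ^+ 2 - w ^+ 3.
Proof. by rewrite -[RHS]addr0 -w_cyc; ring. Qed.

Lemma cyc5E : w ^+ 5 = 1.
Proof. by rewrite exprS; ring: cyc4E. Qed.

Lemma cyclotomic_prod (x : R) :
  (1 - x) * (1 - w * x) * (1 - w ^+ 2 * x) * (1 - w ^+ 3 * x)
    * (1 - w ^+ 4 * x) = 1 - x ^+ 5.
Proof. by ring: cyc5E cyc4E. Qed.

(** The factors are the images of the first one under x -> w^j x, with powers of [w] reduced by w^5
    = 1; hence only powers of x^5 survive. *)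
Lemma cyclotomic_norm (a b c x : R) :
  (a + x * b + x ^+ 2 * c)
  * (a + w * x * b + w ^+ 2 * x ^+ 2 * c)
  * (a + w ^+ 2 * x * b + w ^+ 4 * x ^+ 2 * c)
  * (a + w ^+ 3 * x * b + w * x ^+ 2 * c)
  * (a + w ^+ 4 * x * b + w ^+ 3 * x ^+ 2 * c)
  = a ^+ 5 + x ^+ 5 * b ^+ 5 + x ^+ 10 * c ^+ 5
    - 5 * x ^+ 5 * a * b ^+ 3 * c + 5 * x ^+ 5 * a ^+ 2 * b * c ^+ 2.
Proof. by ring: cyc5E cyc4E. Qed.

Lemma cyclotomic_pow i : ~~ (5 %| i)%N ->
  1 + w ^+ i + (w ^+ i) ^+ 2 + (w ^+ i) ^+ 3 + (w ^+ i) ^+ 4 = 0.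
Proof.
move=> i5.
have -> : w ^+ i = w ^+ (i %% 5).
  by rewrite {1}(divn_eq i 5) exprD mulnC exprM cyc5E expr1n mul1r.
have : (i %% 5 < 5)%N by rewrite ltn_pmod.
rewrite /dvdn in i5; case: (i %% 5)%N i5 => [|[|[|[|[|r]]]]] //= _ _.
- by ring: cyc5E cyc4E.
- by ring: cyc5E cyc4E.
- by ring: cyc5E cyc4E.
Qed.

End FifthRoot.

Section Norm.
Variables (R : comNzRingType) (z : R).
Hypothesis z_cyc : 1 + z + z ^+ 2 + z ^+ 3 + z ^+ 4 = 0.

Definition norm5 (f : pser R) : pser R :=
  f * twist z f * twist (z ^+ 2) f * twist (z ^+ 3) f * twist (z ^+ 4) f.

Lemma norm5M f g : norm5 (f * g) = norm5 f * norm5 g.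
Proof. by rewrite /norm5 !rmorphM /=; ring. Qed.

Lemma norm5_1 : norm5 1 = 1.
Proof. by rewrite /norm5 !rmorph1 !mulr1. Qed.

Lemma agree_norm5 N f g : agree N f g -> agree N (norm5 f) (norm5 g).
Proof. by move=> fg; do !apply: agreeM => //; apply: agree_twist. Qed.

(** If 5 divides i, every twist fixes 1 - q^i; otherwise z^(j i) runs through all fifth roots of
    unity and the factors multiply to 1 - q^(5 i). *)
Lemma norm5_1Bmono (i : nat) :
  norm5 (1 - mono i) =
    if (5 %| i)%N then (1 - mono i) ^+ 5 else 1 - mono (5 * i).
Proof.
have -> : mono (5 * i) = mono i ^+ 5 :> pser R by rewrite monoX mulnC.
rewrite /norm5 !rmorphB !rmorph1 /= !twist_mono.
rewrite -!exprM ![(_ * i)%N]mulnC !exprM !rmorphXn /=.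
case: ifPn => i5.
  rewrite -(divnK i5) mulnC exprM -[const z ^+ 5]rmorphXn /= (cyc5E z_cyc) rmorph1.
  by rewrite !expr1n !mul1r; ring.
rewrite cyclotomic_prod // cyclotomic_pow //.
by rewrite -[RHS](rmorph0 (@const R)) -z_cyc !rmorphD !rmorphXn rmorph1.
Qed.

(** A finite form of norm(f_1) f_25 = f_5^6. The cut-off 5 K makes the indices divisible by 5
    exactly the 5 j with j <= K; the factors 1 - q^(25 j) on the left complete the product over the
    other indices to [V (eprod R (5 * K))]. *)
Lemma norm5_eprod K :
  norm5 (eprod R (5 * K)) * V (V (eprod R K))
    = V (eprod R (5 * K)) * V (eprod R K) ^+ 5.
Proof.
elim: K => [|K IH].
  by rewrite /eprod !big_ord0 norm5_1 !rmorph1 expr1n.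
have ES n : eprod R n.+1 = eprod R n * (1 - mono n.+1).
  by rewrite /eprod big_ord_recr.
have -> : (5 * K.+1 = (5 * K).+1.+4)%N by lia.
rewrite !ES !norm5M !norm5_1Bmono.
have -> : (5 %| (5 * K).+1)%N = false by lia.
have -> : (5 %| (5 * K).+2)%N = false by lia.
have -> : (5 %| (5 * K).+3)%N = false by lia.
have -> : (5 %| (5 * K).+4)%N = false by lia.
have -> : (5 %| (5 * K).+1.+4)%N by lia.
rewrite !rmorphM !rmorphB !rmorph1 /= !V_mono.
have -> : ((5 * K).+1.+4 = 5 * K.+1)%N by lia.
rewrite [RHS](_ : _ = (V (eprod R (5 * K)) * V (eprod R K) ^+ 5) *
  ((1 - mono (5 * (5 * K).+1)) * (1 - mono (5 * (5 * K).+2))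
  * (1 - mono (5 * (5 * K).+3)) * (1 - mono (5 * (5 * K).+4))
  * (1 - mono (5 * (5 * K.+1))) * (1 - mono (5 * K.+1)) ^+ 5)); last by ring.
by rewrite -IH; ring.
Qed.

(** Stated for any [f] approximated by the partial products, so that it applies to the image of
    [euler] over [algC]. *)
Lemma norm5_euler (f : pser R) :
  (forall N, agree N.+1 f (eprod R N)) -> norm5 f * V (V f) = V f ^+ 6.
Proof.
move=> fE; apply: agree_eq => N.
have f5N : agree N f (eprod R (5 * N)).
  by apply: agreeW (fE (5 * N)%N); lia.
have fN : agree N f (eprod R N) by apply: agreeW (fE N).
apply: agree_trans (agree_sym _).
  by apply: agreeM; [apply: agree_norm5 f5N | do 2!apply: agree_V; apply: fN].
rewrite norm5_eprod exprS; apply: agreeM; first exact: agree_V.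
by apply: agreeX; apply: agree_V.
Qed.

Lemma norm5_dissected (a b c : pser R) :
  norm5 (V a + q * V b + q ^+ 2 * V c)
   = V (a ^+ 5 + q * b ^+ 5 + q ^+ 2 * c ^+ 5
        - 5 * q * a * b ^+ 3 * c + 5 * q * a ^+ 2 * b * c ^+ 2).
Proof.
have z5 := cyc5E z_cyc.
have zj j : (z ^+ j) ^+ 5 = 1 by rewrite exprAC z5 expr1n.
pose w : pser R := const z.
have w_cyc : 1 + w + w ^+ 2 + w ^+ 3 + w ^+ 4 = 0.
  by rewrite -(rmorph0 (@const R)) -z_cyc !rmorphD !rmorphXn rmorph1.
have w5 := cyc5E w_cyc.
have Vq : V q = q ^+ 5 :> pser R by rewrite V_mono mono1X.
have tw j : twist (z ^+ j) (V a + q * V b + q ^+ 2 * V c) =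
    V a + w ^+ j * q * V b + (w ^+ j) ^+ 2 * q ^+ 2 * V c.
  rewrite 2!rmorphD 2!rmorphM /= !twist_V // rmorphXn /= twist_mono expr1.
  by rewrite rmorphXn /= -/w; ring.
rewrite /norm5 -{1}[z]expr1 !tw.
transitivity ((V a + q * V b + q ^+ 2 * V c)
  * (V a + w * q * V b + w ^+ 2 * q ^+ 2 * V c)
  * (V a + w ^+ 2 * q * V b + w ^+ 4 * q ^+ 2 * V c)
  * (V a + w ^+ 3 * q * V b + w * q ^+ 2 * V c)
  * (V a + w ^+ 4 * q * V b + w ^+ 3 * q ^+ 2 * V c)).
  by ring: w5.
by rewrite (cyclotomic_norm w_cyc); ring: Vq.
Qed.

End Norm.

(** The two expressions for the norm are compared over [algC]; [U 0] then undoes the outer [V], and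
    injectivity of the integers into [algC] brings the identity back. *)
Lemma norm_identity (f : pser int) (a b c : pser int) :
  (forall N, agree N.+1 f (eprod int N)) ->
  f = V a + q * V b + q ^+ 2 * V c ->
  (a ^+ 5 + q * b ^+ 5 + q ^+ 2 * c ^+ 5
        - 5 * q * a * b ^+ 3 * c + 5 * q * a ^+ 2 * b * c ^+ 2) * V f = f ^+ 6.
Proof.
move=> fE fd; pose phi : {rmorphism int -> algC} := intr.
have [z z_prim] := C_prim_root_exists (isT : (0 < 5)%N).
have z_cyc : 1 + z + z ^+ 2 + z ^+ 3 + z ^+ 4 = 0.
  have z1 : z - 1 != 0.
    rewrite subr_eq0; apply/eqP => z1.
    by have := prim_order_dvd z_prim 1; rewrite z1 expr1n eqxx.
  apply: (mulfI z1); rewrite mulr0.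
  transitivity (z ^+ 5 - 1); first by ring.
  by rewrite (prim_expr_order z_prim) subrr.
have mapE N : agree N.+1 (mapser phi f) (eprod algC N).
  by rewrite -(mapser_eprod phi); apply: agree_mapser.
have := norm5_euler z_cyc mapE.
rewrite {1}fd 2!rmorphD 2!rmorphM /= [mapser _ (q ^+ _)]rmorphXn /=.
rewrite !mapser_mono !mapser_V.
rewrite norm5_dissected // -rmorphM -[V _ ^+ 6]rmorphXn /= => /(congr1 (U 0)).
rewrite !U_V //= => H.
have inj : injective (mapser phi).
  move=> g h gh; apply/funext => n; apply: (@intr_inj algC).
  exact: (congr1 (@^~ n) gh).
apply: inj; rewrite rmorphM rmorphXn /= mapser_V -H; congr (_ * _).
have <- : mapser phi q = q by rewrite mapser_mono.
by ring.
Qed.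

(** * Euler's pentagonal number theorem *)

(** Generalized pentagonal numbers, k ranging over all integers; the quotient is exact and
    nonnegative (see [pentE]). *)
Definition pent (k : int) : nat := absz ((k * (3 * k + 1)) %/ 2)%Z.

Lemma pentE (k : int) : (pent k)%:Z * 2 = k * (3 * k + 1).
Proof.
have k_even : (2 %| k * (3 * k + 1))%Z.
  have [m [km|km]] : exists m : int, k = 2 * m \/ k = 2 * m + 1.
    by exists (k %/ 2)%Z; lia.
  - by apply/dvdzP; exists (m * (6 * m + 1)); rewrite km; ring.
  - by apply/dvdzP; exists ((2 * m + 1) * (3 * m + 2)); rewrite km; ring.
have k_ge0 : 0 <= k * (3 * k + 1) by nia.
rewrite /pent gez0_abs; first by rewrite divzK.
by rewrite divz_ge0.
Qed.

(** Ensures that [centered N] contains every k with pent k <= N, so finite sums suffice. *)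
Lemma pent_ge (k : int) : (`|k| <= pent k)%N.
Proof. by have := pentE k; nia. Qed.

Definition psign (k : int) : int := (-1) ^+ `|k|%N.

(** Each step adds the pair n, -n, matching the two terms that [shanksS] adds. *)
Fixpoint centered (n : nat) : seq int :=
  if n is n'.+1 then [:: n%:Z, - n%:Z & centered n'] else [:: 0].

Lemma mem_centered n (k : int) : (k \in centered n) = (`|k| <= n)%N.
Proof.
elim: n => [|n IH]; first by rewrite inE; lia.
by rewrite /= !in_cons IH; lia.
Qed.

Lemma centered_uniq n : uniq (centered n).
Proof.
elim: n => // n IH; rewrite /= in_cons !mem_centered IH andbT negb_or.
by apply/and3P; split; lia.
Qed.

Section Shanks.
Variable R : comNzRingType.

Definition eprod_from s n : pser R := \prod_(s <= i < n) (1 - mono i.+1).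

(* The left-hand side of Shanks' finite form of the pentagonal number theorem,
   which telescopes in n and whose terms with s > 0 are O(q^(n+1)). *)
Definition shanks n : pser R :=
  \sum_(s < n.+1) (-1) ^+ s * mono (s * n + 'C(s.+1, 2)) * eprod_from s n.

Lemma eprod_from_recl s n : (s < n)%N ->
  eprod_from s n = (1 - mono s.+1) * eprod_from s.+1 n.
Proof. by move=> sn; rewrite /eprod_from big_ltn. Qed.

Lemma eprod_from_recr s n : (s <= n)%N ->
  eprod_from s n.+1 = eprod_from s n * (1 - mono n.+1).
Proof. by move=> sn; rewrite /eprod_from big_nat_recr. Qed.

(** The summands are the differences of the terms of index s in [shanks n.+1] and [shanks n]. The
    partial sums collapse because [eprod_from m n] splits off the factor 1 - q^(m+1). *)
Lemma shanks_telescope n m : (m <= n)%N ->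
  \sum_(s < m.+1) (-1) ^+ s * eprod_from s n * mono 'C(s.+1, 2)
      * (mono (s * n.+1) - mono (s.+1 * n.+1) - mono (s * n))
    = (-1) ^+ m.+1 * eprod_from m n * mono ('C(m.+1, 2) + m.+1 * n.+1).
Proof.
elim: m => [_|m IH mn].
  rewrite big_ord1 /= !mul0n mul1n bin_small // add0n !mono0.
  by ring.
rewrite big_ord_recr /= IH; last exact: ltnW.
rewrite (@eprod_from_recl m n) //.
have -> : 'C(m.+2, 2) = ('C(m.+1, 2) + m.+1)%N by rewrite binS bin1.
pose x : pser R := mono m.+1; pose y : pser R := mono (m.+1 * n).
pose c : pser R := mono 'C(m.+1, 2).
have -> : mono (m.+1 * n.+1) = x * y :> pser R by rewrite monoM; congr mono; lia.
have -> : mono ('C(m.+1, 2) + m.+1 * n.+1) = c * x * y :> pser R.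
  by rewrite !monoM; congr mono; lia.
have -> : mono ('C(m.+1, 2) + m.+1) = c * x :> pser R by rewrite monoM.
have -> : mono ('C(m.+1, 2) + m.+1 + m.+2 * n.+1) = c * x * mono (m.+2 * n.+1) :> pser R.
  by rewrite !monoM.
rewrite -/x -/y !exprS; ring.
Qed.

Lemma shanksS n :
  shanks n.+1 = shanks n + (-1) ^+ n.+1 *
    (mono ('C(n.+2, 2) + n.+1 * n.+1) + mono ('C(n.+1, 2) + n.+1 * n.+1)).
Proof.
rewrite {1}/shanks big_ord_recr /= [eprod_from n.+1 n.+1]big_geq // mulr1.
rewrite mulrDr addnC [X in _ = _ + X]addrC addrA; congr (_ + _).
apply/eqP; rewrite -subr_eq0 opprD addrA subr_eq0 -[X in _ == X]mul1r; apply/eqP.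
have := shanks_telescope (leqnn n).
rewrite [eprod_from n n]big_geq // mulr1 mul1r => <-.
rewrite /shanks -sumrB; apply: eq_bigr => s _.
rewrite eprod_from_recr; last by rewrite -ltnS.
have -> : mono (s.+1 * n.+1) = mono (s * n.+1) * mono n.+1 :> pser R.
  by rewrite monoM; congr mono; lia.
by rewrite -!monoM; ring.
Qed.

Lemma shanks_eprod n : agree n.+1 (shanks n) (eprod R n).
Proof.
move=> m mn; rewrite /shanks big_ord_recl coefpD coefp_sum big1 ?addr0.
  by rewrite mul0n bin_small // mono0 !mul1r /eprod_from big_mkord.
move=> s _; rewrite mulrAC mulrC coefp_monoM ifT //= /bump leq0n.
by rewrite (leq_trans mn) // add1n binS bin1; lia.
Qed.

End Shanks.

Lemma shanks_pentagonal n :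
  shanks int n = \sum_(k <- centered n) const (psign k) * mono (pent k).
Proof.
elim: n => [|n IH].
  rewrite /shanks big_ord1 /= big_seq1 /eprod_from big_geq //.
  by rewrite /psign /pent rmorph1 mulr1 expr0.
rewrite shanksS IH /= 2!big_cons addrA addrC; congr (_ + _).
have pn : ('C(n.+2, 2) + n.+1 * n.+1)%N = pent n.+1.
  by have := pentE n.+1; rewrite bin2 /=; have := @mul_bin_diag n.+1 1; nia.
have pnN : ('C(n.+1, 2) + n.+1 * n.+1)%N = pent (- n.+1%:Z).
  by have := pentE (- n.+1%:Z); rewrite bin2 /=; nia.
by rewrite pn pnN /psign abszN !rmorphXn rmorphN1 mulrDr.
Qed.

Lemma euler_pentagonal N :
  agree N.+1 euler (\sum_(k <- centered N) const (psign k) * mono (pent k)).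
Proof.
rewrite -shanks_pentagonal; apply: agree_trans (agree_sym (@shanks_eprod _ N)).
exact: agree_euler.
Qed.

Lemma coefp_pentsum N (P : pred int) n :
  (\sum_(k <- centered N | P k) const (psign k) * mono (pent k)) n =
  \sum_(k <- centered N | P k) psign k * (n == pent k)%:R.
Proof. by rewrite coefp_sum; apply: eq_bigr => k _; rewrite coefp_constM. Qed.

(** * Ramanujan's relation between the components of f_1 *)

Lemma pent_mod5 (k : int) :
  (pent k %% 5)%N = nth 0%N [:: 0; 2; 2; 0; 1]%N `|(k %% 5)%Z|%N.
Proof.
have := pentE k; have [j [r [-> r5]]] : exists j : int, exists r : nat,
  k = 5 * j + r%:Z /\ (r < 5)%N.
  by exists (k %/ 5)%Z, `|(k %% 5)%Z|%N; lia.
have -> : `|((5 * j + r%:Z) %% 5)%Z|%N = r by lia.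
(* Naming the square [j * j] leaves linear arithmetic for [lia]. *)
have : exists i : int, i = j * j by exists (j * j).
by move: r r5 => [|[|[|[|[|r]]]]] // _ [i ij] /=; rewrite !mulrDr !mulrDl; lia.
Qed.

Lemma euler_coef n N : (n <= N)%N ->
  euler n = \sum_(k <- centered N) psign k * (n == pent k)%:R.
Proof. by move=> nN; rewrite (@euler_pentagonal N) // coefp_pentsum. Qed.

Lemma euler_coef0 n : (forall k, pent k != n) -> euler n = 0.
Proof.
move=> n_pent; rewrite (@euler_coef n n) // big1 // => k _.
by rewrite eq_sym (negbTE (n_pent k)) mulr0.
Qed.

(** Twice the difference of two values is (k - l) (3 (k + l) + 1), whose second factor is 1 modulo
    3, hence nonzero. *)
Lemma pent_inj : injective pent.
Proof.
move=> k l kl; have := pentE k; rewrite kl (pentE l) => e.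
have /eqP : (k - l) * (3 * (k + l) + 1) = 0.
  by transitivity (k * (3 * k + 1) - l * (3 * l + 1)); [ring | rewrite e subrr].
by rewrite mulf_eq0; lia.
Qed.

Lemma euler_coef_pent k : euler (pent k) = psign k.
Proof.
rewrite (@euler_coef _ (pent k)) // (bigD1_seq k) ?centered_uniq //=.
  rewrite eqxx mulr1 big1 ?addr0 // => l lk.
  by rewrite (inj_eq pent_inj) eq_sym (negbTE lk) mulr0.
by rewrite mem_centered pent_ge.
Qed.

Lemma U3_euler : U 3 euler = 0.
Proof.
apply/funext => n; apply: euler_coef0 => k; apply/eqP => pk.
have := pent_mod5 k; rewrite pk (_ : (5 * n + 3) %% 5 = 3)%N; last by lia.
have : (`|(k %% 5)%Z| < 5)%N by lia.
by case: `|(k %% 5)%Z|%N => [|[|[|[|[|r]]]]].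
Qed.

Lemma U4_euler : U 4 euler = 0.
Proof.
apply/funext => n; apply: euler_coef0 => k; apply/eqP => pk.
have := pent_mod5 k; rewrite pk (_ : (5 * n + 4) %% 5 = 4)%N; last by lia.
have : (`|(k %% 5)%Z| < 5)%N by lia.
by case: `|(k %% 5)%Z|%N => [|[|[|[|[|r]]]]].
Qed.

(** Since 24 pent k + 1 = (6 k + 1)^2, this is 6 (5 j - 1) + 1 = - 5 (6 (- j) + 1) squared. *)
Lemma pent_5jB1 j : pent (5 * j - 1) = (25 * pent (- j) + 1)%N.
Proof. by have := pentE (5 * j - 1); have := pentE (- j); nia. Qed.

(** By [pent_mod5], pent k is 1 modulo 5 only for k = 5 j - 1, and then [pent_5jB1] applies. The
    sign arises because 5 j - 1 and j have opposite parity. *)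
Lemma U1_euler : U 1 euler = - V euler.
Proof.
apply/funext => n; rewrite /U coefpN /V.
have [[k nk]|n_pent] := pselect (exists k, pent k = (5 * n + 1)%N).
  have [j kj] : exists j : int, k = 5 * j - 1.
    have := pent_mod5 k; rewrite nk (_ : (5 * n + 1) %% 5 = 1)%N; last by lia.
    move=> k4; exists ((k + 1) %/ 5)%Z; move: k4.
    have : (`|(k %% 5)%Z| < 5)%N by lia.
    by case E: `|(k %% 5)%Z|%N => [|[|[|[|[|r]]]]] //= _ _; lia.
  move: nk; rewrite kj pent_5jB1 => nj.
  rewrite -nj -pent_5jB1 euler_coef_pent.
  have -> : n = (5 * pent (- j))%N.
    by move: nj; move: (pent (- j)) => P; lia.
  rewrite dvdn_mulr // mulKn // euler_coef_pent /psign abszN.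
  rewrite -signr_odd -[in RHS]signr_odd.
  have -> : odd (absz (5 * j - 1)%R) = ~~ odd (absz j) by lia.
  by case: odd; rewrite ?opprK.
rewrite euler_coef0; last by move=> k; apply/eqP => kn; apply: n_pent; exists k.
case: ifP => [/dvdnP[m nm]|_]; last by rewrite oppr0.
rewrite nm mulnK // euler_coef0 ?oppr0 // => j; apply/eqP => jm.
by apply: n_pent; exists (5 * (- j) - 1); rewrite pent_5jB1 opprK jm nm; lia.
Qed.

Lemma euler_dissection :
  euler = V (U 0 euler) + q * V (U 1 euler) + q ^+ 2 * V (U 2 euler).
Proof.
rewrite {1}[euler]dissection !big_ord_recr big_ord0 /= U3_euler U4_euler.
by rewrite rmorph0 !mulr0 !addr0 add0r mono0 mul1r mono1X.
Qed.

(* In the coordinates x = 6 k + 1, y = 6 l + 1, where pent k + pent l is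
   (x^2 + y^2 - 2) / 24, this is the reflection
   (x, y) |-> (- (3 x + 4 y) / 5, (3 y - 4 x) / 5). *)
Definition flip (p : int * int) : int * int :=
  ((- (3 * p.1 + 4 * p.2 + 2)) %/ 5, (3 * p.2 - 4 * p.1 - 1) %/ 5)%Z.

(** In the coordinates above this is y = 3 x modulo 5, which makes both divisions by 5 in the
    reflection exact. *)
Definition flippable (p : int * int) := (5 %| p.2 - 3 * p.1 - 2)%Z.

Lemma flipE p : flippable p ->
  [/\ 5 * (flip p).1 = - (3 * p.1 + 4 * p.2 + 2)
    & 5 * (flip p).2 = 3 * p.2 - 4 * p.1 - 1].
Proof. by rewrite /flippable /flip /= => ?; split; lia. Qed.

Lemma flip_flippable p : flippable p -> flippable (flip p).
Proof.
move=> fp; have [] := flipE fp; move: fp; rewrite /flippable.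
by case: p (flip p) => k l [k' l'] /=; lia.
Qed.

Lemma flipK p : flippable p -> flip (flip p) = p.
Proof.
move=> fp; have [] := flipE fp; have [] := flipE (flip_flippable fp).
case: (flip (flip p)) => k2 l2; case: (flip p) => k1 l1; case: p {fp} => k l /=.
by move=> e1 e2 e3 e4; have [-> ->] : k2 = k /\ l2 = l by lia.
Qed.

Lemma pent_flip p : flippable p ->
  (pent (flip p).1 + pent (flip p).2 = pent p.1 + pent p.2)%N.
Proof.
move=> fp; have [] := flipE fp; case: p fp => k l _; case: (flip _) => k' l' /=.
move=> ek el; have := pentE k; have := pentE l; have := pentE k'; have := pentE l'.
have : 25 * (k' * (3 * k' + 1) + l' * (3 * l' + 1))
     = 25 * (k * (3 * k + 1) + l * (3 * l + 1)).
  transitivity (5 * k' * (3 * (5 * k') + 5) + 5 * l' * (3 * (5 * l') + 5)).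
    by ring.
  by rewrite ek el; ring.
by move: (k' * _) (l' * _) (k * _) (l * _) => *; lia.
Qed.

(** Adding the equations of [flipE] gives 5 (k' + l') = - 7 k - l - 3, so the parity of the sum
    changes. *)
Lemma psign_flip p : flippable p ->
  psign (flip p).1 * psign (flip p).2 = - (psign p.1 * psign p.2).
Proof.
move=> fp; have [] := flipE fp; case: p fp => k l _; case: (flip _) => k' l' /=.
move=> ek el; rewrite /psign -!exprD -signr_odd -[in RHS]signr_odd.
have -> : odd (absz k' + absz l') = ~~ odd (absz k + absz l) by lia.
by case: odd; rewrite ?opprK.
Qed.

(** [flip] is a sign-reversing involution of the index set, so the sum equals its own negative. *)
Lemma flippable_sum0 n :
  \sum_(p <- [seq (k, l) | k <- centered n, l <- centered n] |
     flippable p && (n == pent p.1 + pent p.2)%N) psign p.1 * psign p.2 = 0.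
Proof.
rewrite -big_filter; set s := filter _ _.
have s_uniq : uniq s.
  apply: filter_uniq; apply: allpairs_uniq; rewrite ?centered_uniq //.
  by move=> [? ?] [? ?].
have memS p : (p \in s) = flippable p && (n == pent p.1 + pent p.2)%N.
  rewrite mem_filter; apply: andb_idr => /andP[fp /eqP np].
  apply/allpairsP; exists p; rewrite !mem_centered -surjective_pairing.
  by split=> //; apply: leq_trans (pent_ge _) _; rewrite np ?leq_addr ?leq_addl.
have flip_s p : p \in s -> flip p \in s.
  by rewrite !memS => /andP[fp ?]; rewrite flip_flippable // pent_flip.
have flip_perm : perm_eq (map flip s) s.
  apply: uniq_perm => // [|p].
    rewrite map_inj_in_uniq // => p r; rewrite !memS => /andP[fp _] /andP[fr _] pr.
    by rewrite -(flipK fp) pr flipK.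
  apply/mapP/idP => [[r rs ->]|ps]; first exact: flip_s.
  exists (flip p); first exact: flip_s.
  by move: ps; rewrite memS => /andP[fp _]; rewrite flipK.
set S := \sum_(p <- s) _.
have : S = - S.
  rewrite {1}/S -(perm_big _ flip_perm) big_map -sumrN big_seq [RHS]big_seq.
  by apply: eq_bigr => p; rewrite memS => /andP[fp _]; rewrite psign_flip.
by lia.
Qed.

Lemma coefp_residue (R : comNzRingType) (f : pser R) r n : (r < 5)%N ->
  (mono r * V (U r f)) n = if (n %% 5 == r)%N then f n else 0.
Proof.
move=> r5; rewrite coefp_monoM /V /U; case: ltnP => nr.
  by rewrite (_ : (_ == _) = false) //; lia.
have -> : (5 %| n - r)%N = (n %% 5 == r)%N by lia.
by case: eqP => // nr5; congr f; lia.
Qed.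

Definition pent_term (k : int) : pser int := const (psign k) * mono (pent k).

Definition pent_part (N : nat) (r : int) : pser int :=
  \sum_(k <- centered N) if (k %% 5)%Z == r then pent_term k else 0.

Lemma agree_residue N r : (r < 5)%N ->
  agree N.+1 (mono r * V (U r euler))
    (\sum_(k <- centered N) if (pent k %% 5 == r)%N then pent_term k else 0).
Proof.
move=> r5 n nN; rewrite coefp_residue // coefp_sum (@euler_coef n N) //.
case: eqP => nr.
  apply: eq_bigr => k _; case: (eqVneq (pent k %% 5)%N r) => [_|kr].
    by rewrite /pent_term coefp_constM.
  case: (eqVneq n (pent k)) kr => [<-|_ _]; last by rewrite mulr0.
  by rewrite nr eqxx.
rewrite big1 // => k _; case: eqP => // kr.
rewrite /pent_term coefp_constM /mono; case: eqP => [nk|]; last by rewrite mulr0.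
by rewrite nk in nr.
Qed.

Lemma mod5_cases (k : int) : (k %% 5)%Z = 0 \/ (k %% 5)%Z = 1 \/
  (k %% 5)%Z = 2 \/ (k %% 5)%Z = 3 \/ (k %% 5)%Z = 4.
Proof. by lia. Qed.

Lemma euler_relation : U 0 euler * U 2 euler = - U 1 euler ^+ 2.
Proof.
(* It suffices to treat the full components E_r = q^r V(U r euler): E_0 E_2 and E_1^2 live on
   exponents congruent to 2 modulo 5, and [U 2] recovers the claim. *)
suff H : mono 0 * V (U 0 euler) * (mono 2 * V (U 2 euler))
       + (mono 1 * V (U 1 euler)) ^+ 2 = 0.
  apply/eqP; rewrite -addr_eq0; apply/eqP.
  have := congr1 (U 2) H; rewrite raddf0 => <-.
  rewrite -[LHS](@U_monoV _ 2 2) //; congr (U 2 _).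
  by rewrite mono0 -mono1X; ring.
apply/funext => n; rewrite coefp0.
have A r (r5 : (r < 5)%N) := @agree_residue n r r5.
rewrite (agreeD (agreeM (A 0%N isT) (A 2%N isT)) (agreeX 2 (A 1%N isT))) //.
set S0 := \sum_(k <- _) _; set S2 := \sum_(k <- _) _; set S1 := \sum_(k <- _) _.
pose P := pent_part n.
have mk := pent_mod5.
(* [P] sorts by the residue of k, while the components sort by that of pent k; [pent_mod5]
   translates. *)
have -> : S0 = P 0 + P 3.
  rewrite /P /pent_part -big_split; apply: eq_bigr => k _; rewrite mk.
  by have [->|[->|[->|[->|->]]]] := mod5_cases k; rewrite /= ?addr0 ?add0r.
have -> : S2 = P 1 + P 2.
  rewrite /P /pent_part -big_split; apply: eq_bigr => k _; rewrite mk.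
  by have [->|[->|[->|[->|->]]]] := mod5_cases k; rewrite /= ?addr0 ?add0r.
have -> : S1 = P 4.
  apply: eq_bigr => k _; rewrite mk.
  by have [->|[->|[->|[->|->]]]] := mod5_cases k.
(* Factors are ordered so that the products [P i * P j] are those with j = 3 i + 2 modulo 5, the
   residues of flippable pairs. *)
have -> : (P 0 + P 3) * (P 1 + P 2) + P 4 ^+ 2
  = P 0 * P 2 + P 1 * P 0 + P 2 * P 3 + P 3 * P 1 + P 4 * P 4 by ring.
have -> : P 0 * P 2 + P 1 * P 0 + P 2 * P 3 + P 3 * P 1 + P 4 * P 4 =
  \sum_(k <- centered n) \sum_(l <- centered n)
     if flippable (k, l) then pent_term k * pent_term l else 0.
  rewrite /P /pent_part !big_distrlr /= -!big_split /=.
  apply: eq_bigr => k _; rewrite -!big_split /=; apply: eq_bigr => l _.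
  rewrite /flippable /=.
  have -> : (5 %| l - 3 * k - 2)%Z = (5 %| (l %% 5)%Z - 3 * (k %% 5)%Z - 2)%Z.
    by lia.
  have [->|[->|[->|[->|->]]]] := mod5_cases k;
  by have [->|[->|[->|[->|->]]]] := mod5_cases l;
    rewrite /= ?mulr0 ?mul0r ?addr0 ?add0r.
rewrite -[RHS](flippable_sum0 n) [in RHS]big_mkcond big_allpairs coefp_sum.
apply: eq_bigr => k _; rewrite coefp_sum; apply: eq_bigr => l _ /=.
case: ifP => [fkl|]; last by rewrite coefp0.
rewrite /pent_term.
have -> : const (psign k) * mono (pent k) * (const (psign l) * mono (pent l))
  = const (psign k * psign l) * mono (pent k + pent l).
  by rewrite rmorphM -monoM; ring.
by rewrite coefp_constM /mono; case: eqP; rewrite ?mulr1 ?mulr0.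
Qed.

(** * Congruences modulo powers of 5 *)

Section Congruence.
Implicit Types f g h : pser int.

Definition cong (m : nat) f g := exists h, f = g + m%:R * h.
Arguments cong m%_N f g.

Lemma cong_refl m f : cong m f f.
Proof. by exists 0; rewrite mulr0 addr0. Qed.

Lemma cong_sym m f g : cong m f g -> cong m g f.
Proof. by move=> [h ->]; exists (- h); ring. Qed.

Lemma cong_trans m f g h : cong m f g -> cong m g h -> cong m f h.
Proof. by move=> [x ->] [y ->]; exists (x + y); ring. Qed.

Lemma congM m f f' g g' : cong m f f' -> cong m g g' -> cong m (f * g) (f' * g').
Proof.
by move=> [x ->] [y ->]; exists (f' * y + x * g' + m%:R * x * y); ring.
Qed.

Lemma congX m f g k : cong m f g -> cong m (f ^+ k) (g ^+ k).
Proof.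
move=> fg; elim: k => [|k IH]; first exact: cong_refl.
by rewrite !exprS; apply: congM.
Qed.

(** In the binomial expansion the linear term gains a 5 from its coefficient, and the higher ones
    contain (5 m)^2. This lifts [frobenius5] to moduli 25 and 125. *)
Lemma cong_pow5 m f g : cong (5 * m) f g -> cong (25 * m) (f ^+ 5) (g ^+ 5).
Proof.
move=> [h ->]; pose t : pser int := m%:R.
exists (g ^+ 4 * h + 10 * g ^+ 3 * t * h ^+ 2 + 50 * g ^+ 2 * t ^+ 2 * h ^+ 3
  + 125 * g * t ^+ 3 * h ^+ 4 + 125 * t ^+ 4 * h ^+ 5).
by rewrite !natrM -/t; ring.
Qed.

Lemma coefp_natM (m n : nat) f : (m%:R * f) n = m%:R * f n.
Proof. by rewrite !mulr_natl coefpMn. Qed.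

Lemma cong_U m r f g : cong m f g -> cong m (U r f) (U r g).
Proof.
by move=> [h ->]; exists (U r h); apply/funext => n; rewrite coefpD coefp_natM /U
  coefpD coefp_natM.
Qed.

Lemma coefp_cong m f g n : cong m f g -> exists x : int, f n = g n + m%:R * x.
Proof. by move=> [h ->]; exists (h n); rewrite coefpD coefp_natM. Qed.

Lemma V_const (c : int) : V (const c) = const c.
Proof.
apply/funext => -[|n] //; rewrite /V /const; case: ifP => // n5.
by rewrite ifF //; lia.
Qed.

Lemma fermat5 (c : int) : (5 %| c ^+ 5 - c)%Z.
Proof.
have [j [r [-> r5]]] : exists j : int, exists r : nat, c = 5 * j + r%:R /\ (r < 5)%N.
  by exists (c %/ 5)%Z, (absz (c %% 5)%Z); lia.
pose s : int := r%:R.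
have -> : (5 * j + r%:R) ^+ 5 - (5 * j + r%:R) = (625 * j ^+ 5 + 625 * j ^+ 4 * s
  + 250 * j ^+ 3 * s ^+ 2 + 50 * j ^+ 2 * s ^+ 3 + 5 * j * s ^+ 4 - j) * 5
  + (s ^+ 5 - s) by rewrite -/s; ring.
apply: rpredD; first exact: dvdz_mull.
by rewrite /s; move: r r5 {s} => [|[|[|[|[|r]]]]].
Qed.

(* Splitting off the constant term, f = c + q g, reduces the claim at n to the
   claim for g at n - 5. *)
Lemma frobenius5_coef n f : (5 %| (f ^+ 5 - V f) n)%Z.
Proof.
elim/ltn_ind: n f => n IH f.
pose c := const (f 0%N); pose g : pser int := fun n => f n.+1.
have fE : f = c + q * g.
  apply/funext => m; rewrite coefpD coefp_monoM /c /const /g.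
  by case: m => [|m] /=; rewrite ?addr0 // add0r subn1.
have -> : f ^+ 5 - V f = (c ^+ 5 - c) + mono 5 * (g ^+ 5 - V g)
    + 5%:R * (c ^+ 4 * (q * g) + 2 * c ^+ 3 * (q * g) ^+ 2
    + 2 * c ^+ 2 * (q * g) ^+ 3 + c * (q * g) ^+ 4).
  have Vq : V q = mono 1 ^+ 5 :> pser int by rewrite V_mono mono1X.
  by rewrite {1 2}fE -(mono1X _ 5) rmorphD rmorphM /= V_const Vq; ring.
rewrite 2!coefpD coefp_natM; apply: rpredD; last exact: dvdz_mulr.
apply: rpredD.
  rewrite -rmorphXn -rmorphB /= /const; case: eqP => _ //; exact: fermat5.
rewrite coefp_monoM; case: ltnP => // n5; apply: IH; lia.
Qed.

Lemma frobenius5 f : cong 5 (f ^+ 5) (V f).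
Proof.
exists (fun n => ((f ^+ 5 - V f) n %/ 5)%Z); apply/funext => n.
rewrite coefpD coefp_natM mulrC.
have := frobenius5_coef n f; move/divzK => ->.
by rewrite coefpD coefpN; ring.
Qed.

Lemma frobenius25 f : cong 25 (f ^+ 25) (V f ^+ 5).
Proof. by have := @cong_pow5 1 _ _ (frobenius5 f); rewrite -exprM. Qed.

Lemma frobenius125 f : cong 125 (f ^+ 125) (V f ^+ 25).
Proof. by have := @cong_pow5 5 _ _ (frobenius25 f); rewrite -!exprM. Qed.

End Congruence.
Arguments cong m%_N f g.

(** * Polynomial identities for the 5-dissection *)

Section DissectionPolynomials.
Variables (R : comNzRingType) (x a b c : R).
Hypothesis acE : a * c = - b ^+ 2.

Let F := a + x * b + x ^+ 2 * c.
(** The norm from [cyclotomic_norm]: by [acE] each of its two mixed terms becomes 5 x^5 b^5, whence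
    11 = 1 + 5 + 5. *)
Let N := a ^+ 5 + 11 * x ^+ 5 * b ^+ 5 + x ^+ 10 * c ^+ 5.

(* The expansions below are grouped by the residue modulo 5 of the exponent of
   x, monomials divisible by a * c being eliminated with [acE]. *)
Lemma dissect3 : F ^+ 3 =
  (a ^+ 3 + 3 * x ^+ 5 * b * c ^+ 2) + x * (3 * a ^+ 2 * b + x ^+ 5 * c ^+ 3)
  - 5 * x ^+ 3 * b ^+ 3.
Proof. by rewrite /F; ring: acE. Qed.

Lemma dissect4 : F ^+ 4 =
  (a ^+ 4 - 8 * x ^+ 5 * b ^+ 3 * c)
  + x * (4 * a ^+ 3 * b + 2 * x ^+ 5 * b ^+ 2 * c ^+ 2)
  + x ^+ 2 * (2 * a ^+ 2 * b ^+ 2 + 4 * x ^+ 5 * b * c ^+ 3)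
  + x ^+ 3 * (- 8 * a * b ^+ 3 + x ^+ 5 * c ^+ 4)
  + x ^+ 4 * (- 5 * b ^+ 4).
Proof. by rewrite /F; ring: acE. Qed.

Let X := x * (a ^+ 4 * b - 3 * x ^+ 5 * b ^+ 4 * c)
  + x ^+ 2 * (a ^+ 3 * b ^+ 2 - 2 * x ^+ 5 * b ^+ 3 * c ^+ 2)
  + x ^+ 3 * (- 2 * a ^+ 2 * b ^+ 3 + x ^+ 5 * b ^+ 2 * c ^+ 3)
  + x ^+ 4 * (- 3 * a * b ^+ 4 + x ^+ 5 * b * c ^+ 4).

Lemma dissect5 : F ^+ 5 = N + 5 * X.
Proof. by rewrite /F /N /X; ring: acE. Qed.

Lemma dissect4X : F ^+ 4 * X =
  (- 29 * x ^+ 5 * a ^+ 4 * b ^+ 5 - 6 * x ^+ 10 * b ^+ 8 * c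
   + 4 * x ^+ 15 * b ^+ 3 * c ^+ 6)
  + x * (a ^+ 8 * b + 16 * x ^+ 5 * a ^+ 3 * b ^+ 6
   + 54 * x ^+ 10 * b ^+ 7 * c ^+ 2 + 5 * x ^+ 15 * b ^+ 2 * c ^+ 7)
  + x ^+ 2 * (5 * a ^+ 7 * b ^+ 2 + 54 * x ^+ 5 * a ^+ 2 * b ^+ 7
   + 16 * x ^+ 10 * b ^+ 6 * c ^+ 3 + x ^+ 15 * b * c ^+ 8)
  + x ^+ 3 * (4 * a ^+ 6 * b ^+ 3 - 6 * x ^+ 5 * a * b ^+ 8
   - 29 * x ^+ 10 * b ^+ 5 * c ^+ 4)
  + x ^+ 4 * (b ^+ 4 * (- 17 * N + 125 * x ^+ 5 * b ^+ 5)).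
Proof. by rewrite /F /N /X; ring: acE. Qed.

(** The second factor stands for the product of the other four conjugates of [F]. Since [N] involves
    only x^5, it dissects 1 / F. *)
Lemma dissect_cofactor :
  F * ((a ^+ 4 - 3 * x ^+ 5 * b ^+ 3 * c)
  + x * (- a ^+ 3 * b + 2 * x ^+ 5 * b ^+ 2 * c ^+ 2)
  + x ^+ 2 * (2 * a ^+ 2 * b ^+ 2 - x ^+ 5 * b * c ^+ 3)
  + x ^+ 3 * (- 3 * a * b ^+ 3 + x ^+ 5 * c ^+ 4)
  + x ^+ 4 * (5 * b ^+ 4)) = N.
Proof. by rewrite /F /N; ring: acE. Qed.

End DissectionPolynomials.

(** * Ramanujan's identity and the theorem *)

(* The norm of [euler], as a series in q^5, read as a series in q. *)
Definition enorm : pser int :=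
  U 0 euler ^+ 5 + 11 * q * U 1 euler ^+ 5 + q ^+ 2 * U 2 euler ^+ 5.

Lemma enorm_euler : enorm * V euler = euler ^+ 6.
Proof.
rewrite -(norm_identity agree_euler euler_dissection) /enorm; congr (_ * _).
by ring: euler_relation.
Qed.

Definition euler_inv : pser int := fps_div fps_one euler.

Lemma eulerK : euler * euler_inv = 1.
Proof.
rewrite mulrC; apply/funext; apply: fps_divK.
by rewrite /euler /fps_f /f_partial big_geq // coef1.
Qed.

Lemma V_euler_relation :
  V (U 0 euler) * V (U 2 euler) = - V (U 1 euler) ^+ 2.
Proof. by rewrite -rmorphM euler_relation rmorphN rmorphXn. Qed.

Lemma Vq : V q = q ^+ 5 :> pser int.
Proof. by rewrite V_mono mono1X. Qed.

Lemma V_enorm : V enorm = V (U 0 euler) ^+ 5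
  + 11 * q ^+ 5 * V (U 1 euler) ^+ 5 + q ^+ 10 * V (U 2 euler) ^+ 5.
Proof. by rewrite /enorm; ring: Vq. Qed.

(** Ramanujan's identity. By [dissect_cofactor], 1 / f_1 is [Q] over [V enorm]; the part of [Q] at
    residue 4 is 5 (U 1 euler)^4 = 5 f_5^4, and [enorm_euler] gives 1 / enorm = f_5 / f_1^6. *)
Lemma U4_euler_inv : U 4 euler_inv = 5 * V euler ^+ 5 * euler_inv ^+ 6.
Proof.
have NK : enorm * (V euler * euler_inv ^+ 6) = 1.
  by rewrite mulrA enorm_euler -exprMn eulerK expr1n.
have := dissect_cofactor q V_euler_relation.
rewrite -euler_dissection -V_enorm; set Q := (X in euler * X) => QE.
have IE : euler_inv = V (V euler * euler_inv ^+ 6) * Q.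
  have VNK : V enorm * V (V euler * euler_inv ^+ 6) = 1.
    by rewrite -rmorphM NK rmorph1.
  by rewrite -[LHS]mulr1 -VNK -QE; ring: eulerK.
rewrite {1}IE U_VM //.
have -> : U 4 Q = 5 * U 1 euler ^+ 4.
  pose a := U 0 euler; pose b := U 1 euler; pose c := U 2 euler.
  transitivity (U 4 (V (a ^+ 4 - 3 * q * b ^+ 3 * c)
  + q * V (- a ^+ 3 * b + 2 * q * b ^+ 2 * c ^+ 2)
  + q ^+ 2 * V (2 * a ^+ 2 * b ^+ 2 - q * b * c ^+ 3)
  + q ^+ 3 * V (- 3 * a * b ^+ 3 + q * c ^+ 4)
  + q ^+ 4 * V (5 * b ^+ 4))); last by rewrite U_dissected.
  by congr (U 4 _); rewrite /Q; ring: Vq.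
by rewrite U1_euler; ring.
Qed.

(** In [dissect3] residues 2 and 4 are absent, and residue 3 carries the coefficient -5. *)
Lemma U_euler3 r : (1 < r < 5)%N -> cong 5 (U r (euler ^+ 3)) 0.
Proof.
move=> /andP[r1 r5]; pose a := U 0 euler; pose b := U 1 euler; pose c := U 2 euler.
have -> : euler ^+ 3 = V (a ^+ 3 + 3 * q * b * c ^+ 2)
    + q * V (3 * a ^+ 2 * b + q * c ^+ 3)
    + q ^+ 2 * V 0 + q ^+ 3 * V (- 5 * b ^+ 3) + q ^+ 4 * V 0.
  by rewrite euler_dissection (dissect3 q V_euler_relation); ring: Vq.
rewrite U_dissected //.
move: r r1 r5 => [|[|[|[|[|r]]]]] //= _ _; try exact: cong_refl.
by exists (- b ^+ 3); ring.
Qed.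

(** Write f_1^19 = f_1^4 (f_1^5)^3 with f_1^5 = N + 5 X. Modulo 25 only N^3 f_1^4 + 15 N^2 f_1^4 X
    remains, and the parts at residue 4 give -5 - 15 * 17 = 5 * (-52). *)
Lemma U4_euler19 :
  cong 25 (U 4 (euler ^+ 19)) (5 * (- 52 * U 1 euler ^+ 4 * enorm ^+ 3)).
Proof.
pose a := U 0 euler; pose b := U 1 euler; pose c := U 2 euler.
have := dissect5 q V_euler_relation; have := dissect4X q V_euler_relation.
have := dissect4 q V_euler_relation.
rewrite -euler_dissection -V_enorm; set X := (X in _ = V enorm + 5 * X).
move=> F4E F4XE F5E.
have -> : euler ^+ 19 = V (enorm ^+ 3) * euler ^+ 4
    + V (15 * enorm ^+ 2) * (euler ^+ 4 * X)
    + 25%:R * (euler ^+ 4 * (3 * V enorm * X ^+ 2 + 5 * X ^+ 3)).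
  transitivity (euler ^+ 4 * (euler ^+ 5) ^+ 3); first by ring.
  by rewrite F5E; ring.
have U4F4 : U 4 (euler ^+ 4) = - 5 * b ^+ 4.
  transitivity (U 4 (V (a ^+ 4 - 8 * q * b ^+ 3 * c)
    + q * V (4 * a ^+ 3 * b + 2 * q * b ^+ 2 * c ^+ 2)
    + q ^+ 2 * V (2 * a ^+ 2 * b ^+ 2 + 4 * q * b * c ^+ 3)
    + q ^+ 3 * V (- 8 * a * b ^+ 3 + q * c ^+ 4)
    + q ^+ 4 * V (- 5 * b ^+ 4))); last by rewrite U_dissected.
  by congr (U 4 _); rewrite F4E; ring: Vq.
have U4F4X : U 4 (euler ^+ 4 * X) = b ^+ 4 * (- 17 * enorm + 125 * q * b ^+ 5).
  transitivity (U 4 (V (- 29 * q * a ^+ 4 * b ^+ 5 - 6 * q ^+ 2 * b ^+ 8 * c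
   + 4 * q ^+ 3 * b ^+ 3 * c ^+ 6)
  + q * V (a ^+ 8 * b + 16 * q * a ^+ 3 * b ^+ 6
   + 54 * q ^+ 2 * b ^+ 7 * c ^+ 2 + 5 * q ^+ 3 * b ^+ 2 * c ^+ 7)
  + q ^+ 2 * V (5 * a ^+ 7 * b ^+ 2 + 54 * q * a ^+ 2 * b ^+ 7
   + 16 * q ^+ 2 * b ^+ 6 * c ^+ 3 + q ^+ 3 * b * c ^+ 8)
  + q ^+ 3 * V (4 * a ^+ 6 * b ^+ 3 - 6 * q * a * b ^+ 8
   - 29 * q ^+ 2 * b ^+ 5 * c ^+ 4)
  + q ^+ 4 * V (b ^+ 4 * (- 17 * enorm + 125 * q * b ^+ 5)))); last first.
    by rewrite U_dissected.
  by congr (U 4 _); rewrite F4XE; ring: Vq.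
rewrite !raddfD /= !U_VM // U4F4 U4F4X.
set Y := euler ^+ 4 * _.
exists (75 * enorm ^+ 2 * q * b ^+ 9 + U 4 Y).
have -> : U 4 (25%:R * Y) = 25%:R * U 4 Y by rewrite !mulr_natl raddfMn.
by rewrite -/b; ring.
Qed.

(** Modulo 5, [V euler] is f_1^5 in [enorm_euler], and the invertible f_1^5 cancels. *)
Lemma enorm_cong : cong 5 enorm euler.
Proof.
have -> : enorm = enorm * euler ^+ 5 * euler_inv ^+ 5.
  by rewrite -mulrA -exprMn eulerK expr1n mulr1.
have {2}-> : euler = euler ^+ 6 * euler_inv ^+ 5.
  by rewrite exprS -mulrA -exprMn eulerK expr1n mulr1.
apply: congM (cong_refl _ _); rewrite -enorm_euler.
exact: congM (cong_refl _ _) (frobenius5 _).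
Qed.

Lemma fps_expE (f : pser int) k : fps_exp f k = f ^+ k.
Proof. by elim: k => // k IH; rewrite exprS -IH. Qed.

Definition phi : pser int := (fps_f 2 : pser int) * euler_inv ^+ 3.

Lemma d_phi k : d k = phi ^+ k * euler_inv.
Proof.
have /funext := d_gen k; rewrite !fps_expE => dE.
transitivity ((d k : pser int) * (euler * euler_inv) ^+ (3 * k + 1)).
  by rewrite eulerK expr1n mulr1.
have dE' : (d k : pser int) * euler ^+ (3 * k + 1) = (fps_f 2 : pser int) ^+ k.
  exact: dE.
by rewrite exprMn mulrA dE' /phi exprMn -exprM exprD expr1 mulrA.
Qed.

(** * The descent through the moduli 125, 25 and 5 *)

Section Main.
Variable c : nat.

Definition C1 : pser int := V euler ^+ 5 * euler_inv ^+ 6 * phi ^+ (25 * c).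
Definition C2 : pser int :=
  - 52 * U 1 euler ^+ 4 * enorm ^+ 3 * phi ^+ (5 * c).

Lemma U4_d : cong 125 (U 4 (d (125 * c))) (5%:R * C1).
Proof.
have -> : 5%:R * C1 = U 4 (V (phi ^+ (25 * c)) * euler_inv).
  by rewrite U_VM // U4_euler_inv /C1; ring.
apply: cong_U; rewrite d_phi; apply: congM (cong_refl _ _).
by rewrite exprM rmorphXn exprM; apply: congX; apply: frobenius125.
Qed.

Lemma U4_C1 : cong 25 (U 4 C1) (5%:R * C2).
Proof.
(* Modulo 25, f_5^5 is f_1^25, and 25 - 6 = 19. *)
have C1E : cong 25 C1 (V (phi ^+ (5 * c)) * euler ^+ 19).
  have -> : V (phi ^+ (5 * c)) * euler ^+ 19
      = euler ^+ 25 * euler_inv ^+ 6 * V (phi ^+ (5 * c)).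
    rewrite (_ : euler ^+ 25 * _ = euler ^+ 19 * (euler * euler_inv) ^+ 6).
      by rewrite eulerK; ring.
    by ring.
  apply: congM; first apply: congM (cong_refl _ _).
    exact/cong_sym/frobenius25.
  by rewrite exprM rmorphXn exprM; apply: congX; apply: frobenius25.
apply: cong_trans (cong_U 4 C1E) _; rewrite U_VM //.
have -> : 5%:R * C2 = phi ^+ (5 * c) * (5 * (- 52 * U 1 euler ^+ 4 * enorm ^+ 3)).
  by rewrite /C2; ring.
exact: congM (cong_refl _ _) U4_euler19.
Qed.

Lemma U_C2 r : (1 < r < 5)%N -> cong 5 (U r C2) 0.
Proof.
(* [U 1 euler] is a series in q^5 and so is [phi ^+ (5 * c)] modulo 5; only enorm^3, congruent to
   f_1^3, is not absorbed into [V]. *)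
move=> r5; have C2E : cong 5 C2 (V (- 52 * euler ^+ 4 * phi ^+ c) * euler ^+ 3).
  have -> : V (- 52 * euler ^+ 4 * phi ^+ c) * euler ^+ 3
     = - 52 * U 1 euler ^+ 4 * euler ^+ 3 * V (phi ^+ c).
    by rewrite U1_euler; ring.
  apply: congM; first by apply: congM (cong_refl _ _) (congX _ enorm_cong).
  by rewrite exprM rmorphXn; apply: congX; apply: frobenius5.
apply: cong_trans (cong_U r C2E) _; rewrite U_VM //; last by case/andP: r5.
by rewrite -[X in cong _ _ X](mulr0 (- 52 * euler ^+ 4 * phi ^+ c));
  apply: congM (cong_refl _ _) (U_euler3 r5).
Qed.

Lemma d_mod125 n r : (1 < r < 5)%N ->
  (125 %| d (125 * c) (125 * n + (25 * r + 24)))%Z.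
Proof.
move=> r5.
(* The index is unfolded as 5 (5 (5 n + r) + 4) + 4; each of the three extractions contributes one
   factor 5. *)
have -> : d (125 * c) (125 * n + (25 * r + 24))
  = U 4 (d (125 * c)) (5 * (5 * n + r) + 4)%N by rewrite /U; congr d; lia.
have [x ->] := coefp_cong (5 * (5 * n + r) + 4) U4_d.
have [y yE] := coefp_cong (5 * n + r) U4_C1.
have [z zE] := coefp_cong n (U_C2 r5).
rewrite coefp_natM -[C1 _]/(U 4 C1 (5 * n + r)%N) yE coefp_natM.
rewrite -[C2 _]/(U r C2 n) zE coefp0 add0r.
by apply/dvdzP; exists (z + y + x); ring.
Qed.

End Main.

Local Close Scope ring_scope.

Theorem theorem1p6 (c n : nat) :
  [/\ (d (125 * c) (125 * n + 74) = 0 %[mod 125])%Z,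
      (d (125 * c) (125 * n + 99) = 0 %[mod 125])%Z &
      (d (125 * c) (125 * n + 124) = 0 %[mod 125])%Z].
Proof.
have mod125 (r : nat) : 1 < r < 5 ->
    (d (125 * c) (125 * n + (25 * r + 24)) = 0 %[mod 125])%Z.
  by move=> r5; apply/eqP; rewrite eqz_mod_dvd subr0; apply: d_mod125.
by split; [apply: (mod125 2) | apply: (mod125 3) | apply: (mod125 4)].
Qed.
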